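(* Let $\pi\colon U\to B$ be a $B$-field. Then $\pi$ is a Urysohn field over $B$ if and only if $\pi$ is $B$-universal and every finite partial isometric matching of $\pi$ can be extended to an automorphism of $\pi$.
   Context: A Polish space means a complete separable metric space. A $B$-field is a $1$-Lipschitz map $\pi\colon X\to B$ where $X$ and $B$ are Polish spaces. A one-point metric extension of a metric space $A$ is a metric space $A^\ast=A\sqcup\{a^\ast\}$ whose metric restricts to the given one on $A$. Isometric embeddings are distance-preserving maps, not necessarily surjective. A $B$-field $\pi\colon U\to B$ is a Urysohn field over $B$ if for each finite (possibly empty) subspace $A\subseteq U$ and each $1$-Lipschitz map $\phi\colon A^\ast\to B$ defined on a one-point metric extension $A^\ast=A\sqcup\{a^\ast\}$ and satisfying $\phi|_A=\pi|_A$, there exists an isometric embedding $\imath\colon A^\ast\to U$ such that $\imath|_A$ is the inclusion map and $\pi\circ\imath=\phi$. A $B$-field $\pi\colon U\to B$ is $B$-universal if for any $B$-field $\phi\colon Y\to B$ there is an isometric embedding $\imath\colon Y\to U$ with $\pi\circ\imath=\phi$. An automorphism of $\pi\colon U\to B$ is a bijective isometry $\psi\colon U\to U$ with $\pi\circ\psi=\pi$. A partial isometric matching of $\pi$ is a bijective isometry $\phi\colon A\to A'$ between subspaces of $U$ with $\pi|_{A'}\circ\phi=\pi|_A$; it is finite if $|A|=|A'|<\infty$. *)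

(* Defs.v *)
From HB Require Import structures.
From mathcomp Require Import all_boot all_order all_algebra.
From mathcomp Require Import all_classical all_reals all_analysis.

Set Implicit Arguments.
Unset Strict Implicit.
Unset Printing Implicit Defensive.

Import Order.TTheory GRing.Theory Num.Theory.

Local Open Scope classical_set_scope.
Local Open Scope ring_scope.

Section Subspace.
Context {R : realType} {T : metricType R} (A : set T).

Let sub_dist (x y : A) : R := mdist (\val x) (\val y).

Let sub_dist_ge0 x y : 0 <= sub_dist x y.
Proof. exact: mdist_ge0. Qed.

Let sub_dist_positivity x y : sub_dist x y = 0 -> x = y.
Proof. by move=> /mdist_positivity /val_inj. Qed.

Let sub_ballE (x : A) d : ball x d = [set y | sub_dist x y < d].
Proof.
by rewrite -initial_ballE; apply/seteqP; split=> y; rewrite /= ballEmdist.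
Qed.

HB.instance Definition _ := PseudoMetric_isMetric.Build R (A : Type)
  sub_dist_ge0 sub_dist_positivity sub_ballE.

End Subspace.

(* The library's [completeType] and [completePseudoMetricType] are pointed;
   here completeness is a predicate, so that the empty space is allowed. *)
Definition complete_space (T : uniformType) :=
  forall F : set_system T, ProperFilter F -> cauchy F -> exists l : T, F --> l.

Definition separable_space (T : topologicalType) :=
  exists2 D : set T, countable D & dense D.

Definition polish {R : realType} (T : metricType R) :=
  complete_space T /\ separable_space T.

Definition one_lipschitz {R : realType} {X Y : metricType R} (f : X -> Y) :=
  forall x y, mdist (f x) (f y) <= mdist x y.

Definition isometric_embedding {R : realType} {X Y : metricType R}
    (f : X -> Y) :=
  forall x y, mdist (f x) (f y) = mdist x y.

(* [is_field pi] states that [pi] is a B-field, where B is its codomain. *)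
Definition is_field {R : realType} {X B : metricType R} (pi : X -> B) :=
  [/\ polish X, polish B & one_lipschitz pi].

(* A metric on the disjoint union of A and a new point that restricts to the
   given one on A. The carrier is [option A]: [Some] is the inclusion of A and
   [None] is the new point. *)
Record one_point_extension {R : realType} {T : metricType R} (A : set T) := {
  ext_dist : option A -> option A -> R ;
  ext_distxx : forall p, ext_dist p p = 0 ;
  ext_dist_positivity : forall p q, ext_dist p q = 0 -> p = q ;
  ext_dist_sym : forall p q, ext_dist p q = ext_dist q p ;
  ext_dist_triangle :
    forall q p r, ext_dist p r <= ext_dist p q + ext_dist q r ;
  ext_dist_restr :
    forall x y : A, ext_dist (Some x) (Some y) = mdist (\val x) (\val y)
}.

Definition ext_space {R : realType} {T : metricType R} {A : set T}
  (E : one_point_extension A) : Type := option A.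

Section ExtSpace.
Context {R : realType} {T : metricType R} {A : set T}.
Variable E : one_point_extension A.

HB.instance Definition _ := Choice.copy (ext_space E) (option A).

HB.instance Definition _ := isMetric.Build R (ext_space E)
  (@ext_distxx _ _ _ E) (@ext_dist_positivity _ _ _ E)
  (@ext_dist_sym _ _ _ E) (@ext_dist_triangle _ _ _ E).

End ExtSpace.

Definition ext_incl {R : realType} {T : metricType R} {A : set T}
  (E : one_point_extension A) (x : A) : ext_space E := Some x.

Definition urysohn_field {R : realType} {U B : metricType R} (pi : U -> B) :=
  is_field pi /\
  forall (A : set U) (E : one_point_extension A) (phi : ext_space E -> B),
    finite_set A ->
    one_lipschitz phi ->
    (forall x : A, phi (ext_incl E x) = pi (\val x)) ->
    exists i : ext_space E -> U,
      [/\ isometric_embedding i,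
          forall x : A, i (ext_incl E x) = \val x
        & pi \o i =1 phi].

Definition universal_field {R : realType} {U B : metricType R} (pi : U -> B) :=
  is_field pi /\
  forall (Y : metricType R) (phi : Y -> B), is_field phi ->
    exists2 i : Y -> U, isometric_embedding i & pi \o i =1 phi.

Definition automorphism {R : realType} {U B : metricType R} (pi : U -> B)
    (psi : U -> U) :=
  [/\ bijective psi, isometric_embedding psi & pi \o psi =1 pi].

Definition partial_isometric_matching {R : realType} {U B : metricType R}
    (pi : U -> B) (A A' : set U) (f : A -> A') :=
  [/\ bijective f, isometric_embedding f
    & forall x : A, pi (\val (f x)) = pi (\val x)].

Definition extends {T : Type} (A A' : set T) (psi : T -> T) (f : A -> A') :=
  forall x : A, psi (\val x) = \val (f x).

(* Main.v *)
Require Import Defs.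
From mathcomp Require Import all_boot all_order all_algebra.
From mathcomp Require Import all_classical all_reals all_analysis.
From mathcomp Require Import lra.

Set Implicit Arguments.
Unset Strict Implicit.
Unset Printing Implicit Defensive.

Import Order.TTheory GRing.Theory Num.Theory.

Local Open Scope classical_set_scope.
Local Open Scope ring_scope.

(** The proof is the classical characterization of the Urysohn space by
universality and homogeneity, carried out over the base B.

Everything is expressed through matchings between two fields phi : X -> B and
pi : Y -> B: relations between X and Y that preserve distances and the base
point. If Y is complete and the domain of a matching is dense in X, each x in X
determines a Cauchy filter on Y, formed by the partners of the points near x;
its limits give an isometric embedding X -> Y over B
([dense_matching_extension]). When the matching is dense on both sides, the two
embeddings obtained from it and from its converse are mutually inverse
([dense_dom_converse_inverse]).

A Urysohn field U -> B makes it possible to add any given point of X to the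
domain of a finite matching from X to U: the point, seen from its already
matched companions, is a one-point extension of a finite subspace of U
([urysohn_forth]). Doing this along a countable dense subset of X yields
universality. When X = U is the Urysohn field itself the same can be done to
the converse matching, and the alternation of the two (back and forth) turns a
given finite matching into one that is dense on both sides, hence into an
automorphism.

Conversely, let A be finite in U and E a one-point extension of A over B. The
space E is finite, hence Polish, so universality embeds it in U; this copy of A
may be misplaced, but it is finitely matched with A itself, and an automorphism
extending this matching carries the copy of E to the required position
([universal_homogeneous_urysohn]). *)

(** * Metric preliminaries *)

Lemma eq_of_mdist_le {R : realType} {T : metricType R} (x y : T) :
  (forall e : R, 0 < e -> mdist x y <= e) -> x = y.
Proof.
move=> h; apply: mdist_positivity; apply/eqP; rewrite eq_le mdist_ge0 andbT.
by apply/ler_addgt0Pl => e e0; rewrite addr0; exact: h.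
Qed.

Lemma dense_mdist {R : realType} {T : metricType R} (D : set T) :
  dense D -> forall (x : T) (e : R), 0 < e -> exists2 y, D y & mdist x y < e.
Proof.
move=> dD x e e0.
have [|y [yx Dy]] := dD (ball x e)° _ (open_interior _).
  by exists x; exact: nbhsx_ballx.
by exists y => //; move/interior_subset: yx; rewrite ballEmdist.
Qed.

Lemma finite_pos_lower_bound {R : realType} (A : set R) :
  finite_set A -> (forall r, A r -> 0 < r) ->
  exists2 e : R, 0 < e & forall r, A r -> e <= r.
Proof.
move=> /finite_seqP[s ->]; elim: s => [|a s IH] pos.
  by exists 1 => // r; rewrite /= in_nil.
have [r /= rs|e e0 He] := IH; first by apply: pos; rewrite /= inE rs orbT.
have a0 : 0 < a by apply: pos; rewrite /= inE eqxx.
exists (Num.min a e); first by rewrite lt_min a0.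
move=> r /=; rewrite inE => /orP[/eqP->|/He re]; first by rewrite ge_min lexx.
by rewrite ge_min re orbT.
Qed.

(** A Cauchy filter contains a ball of any given radius; below the least nonzero
distance a ball is a singleton, so the filter is principal. *)
Lemma finite_polish {R : realType} (T : metricType R) :
  finite_set [set: T] -> polish T.
Proof.
move=> finT; split; last first.
  exists [set: T]; first exact: finite_set_countable.
  by move=> O [x Ox] _; exists x.
pose S := (fun p : T * T => mdist p.1 p.2) @` setT `\ 0.
have finS : finite_set S.
  apply: sub_finite_set (finite_image (fun p : T * T => mdist p.1 p.2)
    (finite_setX finT finT)).
  by move=> r [[p _ <-] _]; exists p.
have posS r : S r -> 0 < r.
  by move=> [[p _ <-] /eqP]; rewrite lt_neqAle mdist_ge0 eq_sym andbT.
have [e e0 He] := finite_pos_lower_bound finS posS.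
move=> F PF /cauchyP /(_ e e0)[x Fx]; exists x.
have subx : ball x e `<=` [set x].
  move=> y; rewrite ballEmdist /= => xy; apply/esym/mdist_positivity.
  apply: contrapT => xy0; suff: e <= mdist x y by rewrite leNgt xy.
  by apply: He; split => //; exists (x, y).
move=> P /nbhs_singleton Px; apply: filterS Fx => y /subx ->; exact: Px.
Qed.

(** Pulling back the metric along an injective map gives the metric axioms for
free. The definition is transparent so that distances in the extension compute
to distances in Y. *)
Definition pullback_extension {R : realType} {T Y : metricType R} (A : set T)
    (h : option A -> Y) (hinj : injective h)
    (hA : forall x y : A,
        mdist (h (Some x)) (h (Some y)) = mdist (\val x) (\val y)) :
    one_point_extension A.
Proof.
refine (@Build_one_point_extension R T A (fun p q => mdist (h p) (h q))
  _ _ _ _ hA).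
- by move=> p; exact: mdistxx.
- by move=> p q /mdist_positivity /hinj.
- by move=> p q; exact: metric_sym.
- by move=> q p r; exact: metric_triangle.
Defined.

(** * Matchings between two fields *)

Section Matching.
Context {R : realType} {X Y B : metricType R}.

Definition matching (phi : X -> B) (pi : Y -> B) (M : set (X * Y)) :=
  (forall p q, M p -> M q -> mdist p.1 q.1 = mdist p.2 q.2) /\
  (forall p, M p -> phi p.1 = pi p.2).

Definition converse (M : set (X * Y)) : set (Y * X) := [set p | M (p.2, p.1)].

Definition dense_dom (M : set (X * Y)) :=
  forall (x : X) (e : R), 0 < e -> exists2 p, M p & mdist x p.1 < e.

(** With f injective on D, this is the n-th of countably many requirements which
together put D inside the domain of M. Indexing D through f rather than by an
enumeration spares a case distinction when D is finite or empty. *)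
Definition dom_meets (D : set X) (f : X -> nat) (n : nat) (M : set (X * Y)) :=
  forall x, D x -> f x = n -> exists y, M (x, y).

End Matching.

Lemma matching_converse {R : realType} {X Y B : metricType R} (phi : X -> B)
    (pi : Y -> B) (M : set (X * Y)) :
  matching phi pi M -> matching pi phi (converse M).
Proof.
move=> [iM oM]; split=> [[a b] [c d] h1 h2|[a b] h].
  by rewrite /= -(iM _ _ h1 h2).
by rewrite /= -(oM _ h).
Qed.

Lemma finite_converse {R : realType} {X Y : metricType R} (M : set (X * Y)) :
  finite_set M -> finite_set (converse M).
Proof.
move=> /(finite_image (fun p => (p.2, p.1))); apply: sub_finite_set.
by move=> [a b] h; exists (b, a).
Qed.

(** * Adding a point to a finite matching *)

Section Forth.
Context {R : realType} {X U B : metricType R} (phi : X -> B) (pi : U -> B).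
Hypothesis upi : urysohn_field pi.
Hypothesis lphi : one_lipschitz phi.

Lemma matching_setU1 (M : set (X * U)) x u :
  matching phi pi M -> phi x = pi u ->
  (forall q, M q -> mdist x q.1 = mdist u q.2) ->
  matching phi pi (M `|` [set (x, u)]).
Proof.
move=> [iM oM] xu hq; split=> [p q [Mp|->] [Mq|->]|p [Mp|->]] //=.
- exact: iM.
- by rewrite metric_sym hq // metric_sym.
- exact: hq.
- by rewrite !mdistxx.
- exact: oM.
Qed.

(** Let A be the range of M. Transporting the distances from x to the domain of M
along M defines a one-point extension of A, mapped to B by phi; the Urysohn
property places the new point in U, and this is the partner of x. *)
Lemma urysohn_forth (M : set (X * U)) :
  finite_set M -> matching phi pi M -> forall x,
  exists M', [/\ finite_set M', matching phi pi M', M `<=` M'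
                & exists u, M' (x, u)].
Proof.
move=> finM mM x; have [[u Mxu]|nx] := pselect (exists u, M (x, u)).
  by exists M; split=> //; exists u.
have [iM oM] := mM.
pose A := snd @` M.
have /choice[g gM] : forall a : A, exists y, M (y, \val a).
  by move=> a; have [[y u] Myu <-] := set_valP a; exists y.
(* Some a is read as the point of X matched with a, None as x itself. *)
pose h (p : option A) := if p is Some a then g a else x.
have hA (a b : A) : mdist (h (Some a)) (h (Some b)) = mdist (\val a) (\val b).
  exact: (iM _ _ (gM a) (gM b)).
have hinj : injective h.
  move=> [a|] [b|] //= hab.
  - congr Some; apply/val_inj/mdist_positivity.
    by rewrite -hA /= hab mdistxx.
  - by case: nx; exists (\val a); rewrite -hab.
  - by case: nx; exists (\val b); rewrite hab.
pose E := pullback_extension hinj hA.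
have [] := upi.2 A E (phi \o h).
- exact: finite_image.
- by move=> p q; exact: lphi.
- by move=> a; exact: (oM _ (gM a)).
move=> i [ii iA ipi]; exists (M `|` [set (x, i None)]); split.
- by rewrite finite_setU; split.
- apply: matching_setU1 => //; first by rewrite -[RHS]/((pi \o i) None) ipi.
  move=> [y u] Myu /=.
  have Au : A u by exists (y, u).
  pose a : A := SigSub (mem_set Au).
  have <- : g a = y.
    by apply: mdist_positivity; rewrite (iM _ _ (gM a) Myu) mdistxx.
  have -> : u = i (ext_incl E a) by rewrite iA.
  by rewrite ii.
- by move=> p Mp; left.
- by exists (i None); right.
Qed.

Lemma urysohn_dom_meets (D : set X) (f : X -> nat) (n : nat) :
  {in D &, injective f} -> forall M : set (X * U),
  finite_set M -> matching phi pi M ->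
  exists M', [/\ finite_set M', matching phi pi M', M `<=` M'
                & dom_meets D f n M'].
Proof.
move=> finj M finM mM.
have [[x [Dx fx]]|nx] := pselect (exists x, D x /\ f x = n); last first.
  by exists M; split=> // x Dx fx; case: nx; exists x.
have [M' [? ? ? [u xu]]] := urysohn_forth finM mM x.
exists M'; split=> // y Dy fy; exists u.
by rewrite (finj y x) ?inE // fy fx.
Qed.

End Forth.

(** * Limits of matchings *)

Section Chain.
Context {R : realType} {X Y B : metricType R} (phi : X -> B) (pi : Y -> B).

(** Countably many requirements, each stable under enlargement and attainable
from any finite matching, can be met simultaneously: meet them one after the
other and take the union of the resulting chain. The union need not be finite,
but a condition on pairs of its elements is checked at a single stage. *)
Lemma matching_chain (G : nat -> set (set (X * Y))) (M0 : set (X * Y)) :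
  finite_set M0 -> matching phi pi M0 ->
  (forall n M M', M `<=` M' -> G n M -> G n M') ->
  (forall n M, finite_set M -> matching phi pi M ->
    exists M', [/\ finite_set M', matching phi pi M', M `<=` M' & G n M']) ->
  exists M, [/\ matching phi pi M, M0 `<=` M & forall n, G n M].
Proof.
move=> fin0 m0 monoG step.
(* The conclusion is conditional so that F is total on all relations. *)
have /choice[F FP] : forall nM : nat * set (X * Y), exists M',
    finite_set nM.2 -> matching phi pi nM.2 ->
    [/\ finite_set M', matching phi pi M', nM.2 `<=` M' & G nM.1 M'].
  move=> [n M] /=; have [[fM mM]|nM] :=
    pselect (finite_set M /\ matching phi pi M).
    by have [M' ?] := step n M fM mM; exists M'.
  by exists M => fM mM; case: nM.
pose S := fix S n := if n is k.+1 then F (k, S k) else M0.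
have Sok n : finite_set (S n) /\ matching phi pi (S n).
  by elim: n => [//|n [fS mS]] /=; have [] := FP (n, S n) fS mS.
have SP n : S n `<=` S n.+1 /\ G n (S n.+1).
  by have [fS mS] := Sok n; have [] := FP (n, S n) fS mS.
have Smono m n : (m <= n)%N -> S m `<=` S n.
  move=> /subnK <-; elim: (n - m)%N => [//|k IH].
  by rewrite addSn; apply: (subset_trans IH); exact: (SP _).1.
exists (\bigcup_n S n); split.
- split=> [p q [m _ mp] [n _ nq]|p [m _ mp]]; last exact: (Sok m).2.2.
  apply: (Sok (maxn m n)).2.1.
  + by apply: Smono mp; exact: leq_maxl.
  + by apply: Smono nq; exact: leq_maxr.
- by move=> p p0; exists 0%N.
- by move=> n; apply: monoG (SP n).2 => p Sp; exists n.+1.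
Qed.

Lemma dom_meets_dense (D : set X) (f : X -> nat) (M : set (X * Y)) :
  dense D -> (forall n, dom_meets D f n M) -> dense_dom M.
Proof.
move=> dD DM x e e0; have [z Dz xz] := dense_mdist dD x e0.
by have [y Mzy] := DM _ z Dz erefl; exists (z, y).
Qed.

(** The partners of points close to x form a Cauchy filter, because M preserves
distances; the desired y is its limit. *)
Lemma dense_matching_limit (M : set (X * Y)) :
  complete_space Y -> matching phi pi M -> dense_dom M ->
  forall x, exists y, forall q, M q -> mdist x q.1 = mdist y q.2.
Proof.
move=> cY [iM _] dM x.
pose near_x (e : R) := [set y | exists2 p, M p /\ mdist x p.1 < e & y = p.2].
pose F : set_system Y := filter_from [set e | 0 < e] near_x.
have PF : ProperFilter F.
  apply: filter_from_proper => [|e e0]; last first.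
    by have [p Mp xp] := dM x e e0; exists p.2, p.
  apply: filter_from_filter; first by exists 1 => /=.
  move=> a b a0 b0; exists (Num.min a b); first by rewrite /= lt_min a0.
  move=> y [p [Mp]]; rewrite lt_min => /andP[pa pb ->].
  by split; exists p.
have cF : cauchy F.
  apply/cauchy_exP => e e0; have e20 : 0 < e / 2 by rewrite divr_gt0.
  have [p Mp xp] := dM x _ e20; exists p.2, (e / 2) => // y [q [Mq xq] ->].
  rewrite ballEmdist /= -(iM _ _ Mp Mq).
  have := metric_triangle p.1 x q.1; rewrite (metric_sym p.1 x); lra.
have [y Fy] := cY F PF cF; exists y => q Mq.
(* One pair of M witnesses both the proximity to x and that to y. *)
have close e : 0 < e -> exists p, [/\ M p, mdist x p.1 < e & mdist y p.2 < e].
  move=> e0; have [d d0 dy] := fcvg_ball Fy e0.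
  have m0 : 0 < Num.min d e by rewrite lt_min e0 andbT; exact: d0.
  have [p Mp] := dM x _ m0; rewrite lt_min => /andP[xd xe].
  exists p; split=> //; have : near_x d p.2 by exists p.
  by move=> /dy; rewrite ballEmdist.
apply/eqP; rewrite -subr_eq0 -normr_le0; apply/ler_addgt0Pl => e e0.
rewrite addr0; have e20 : 0 < e / 2 by rewrite divr_gt0.
have [p [Mp xp yp]] := close _ e20.
have pq := iM _ _ Mp Mq.
have := metric_triangle x p.1 q.1; have := metric_triangle p.1 x q.1.
have := metric_triangle y p.2 q.2; have := metric_triangle p.2 y q.2.
rewrite (metric_sym p.1 x) (metric_sym p.2 y) ler_norml; lra.
Qed.

(** The distances to the matched points determine i; that i is isometric and
lies over B then passes from M to the limit, as the 1-Lipschitz maps phi and pi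
agree along M. The last clause expresses that i extends M in a form that also
serves to identify inverses. *)
Lemma dense_matching_extension (M : set (X * Y)) :
  complete_space Y -> one_lipschitz phi -> one_lipschitz pi ->
  matching phi pi M -> dense_dom M ->
  exists i : X -> Y, [/\ isometric_embedding i, pi \o i =1 phi
    & forall x q, M q -> mdist x q.1 = mdist (i x) q.2].
Proof.
move=> cY lphi lpi mM dM.
have /choice[i iP] := dense_matching_limit cY mM dM.
have e2 (e : R) : 0 < e -> 0 < e / 2 by move=> ?; rewrite divr_gt0.
exists i; split=> // [x z|x].
  apply/eqP; rewrite -subr_eq0 -normr_le0; apply/ler_addgt0Pl => e e0.
  rewrite addr0; have [p Mp xp] := dM x _ (e2 _ e0).
  have := iP x p Mp; have := iP z p Mp.
  have := metric_triangle x p.1 z; have := metric_triangle p.1 x z.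
  have := metric_triangle (i x) p.2 (i z).
  have := metric_triangle p.2 (i x) (i z).
  rewrite (metric_sym p.1 x) (metric_sym p.2 (i x)).
  rewrite (metric_sym p.1 z) (metric_sym p.2 (i z)) ler_norml; lra.
apply: eq_of_mdist_le => e e0; have [p Mp xp] := dM x _ (e2 _ e0).
have := lpi (i x) p.2; rewrite -(iP x p Mp) -(mM.2 p Mp) => h1.
have := lphi p.1 x; rewrite (metric_sym p.1 x) => h2.
have /= := metric_triangle (pi (i x)) (phi p.1) (phi x); lra.
Qed.

End Chain.

(** The points x and j (i x) have the same distances to the domain of M, which
contains points arbitrarily close to x. *)
Lemma dense_dom_converse_inverse {R : realType} {X Y : metricType R}
    (M : set (X * Y)) (i : X -> Y) (j : Y -> X) :
  dense_dom M ->
  (forall x q, M q -> mdist x q.1 = mdist (i x) q.2) ->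
  (forall y q, converse M q -> mdist y q.1 = mdist (j y) q.2) ->
  cancel i j.
Proof.
move=> dM iP jP x; apply: eq_of_mdist_le => e e0.
have e20 : 0 < e / 2 by rewrite divr_gt0.
have [[z y] Mzy /= xz] := dM x _ e20.
have /= := iP x _ Mzy; have /= := jP (i x) (y, z) Mzy.
have := metric_triangle (j (i x)) z x; rewrite (metric_sym z x); lra.
Qed.

(** * Urysohn fields: universality and homogeneity *)

Section Urysohn.
Context {R : realType} {U B : metricType R} (pi : U -> B).

(** Only the forth direction is available here, since phi is an arbitrary field:
starting from the empty matching, the domain is made dense in Y. *)
Lemma urysohn_universal : urysohn_field pi -> universal_field pi.
Proof.
move=> upi; have [[[cU _] _ lpi] _] := upi; split=> [|Y phi]; first exact: upi.1.
move=> [[_ [D /countable_injP[f finj] dD]] _ lphi].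
have m0 : matching phi pi set0 by split.
have [|n M fM mM|M [mM _ GM]] :=
  matching_chain (G := dom_meets D f) (@finite_set0 _) m0.
- by move=> n M M' MM' DM x Dx /(DM x Dx)[u Mxu]; exists u; exact: MM'.
- exact: urysohn_dom_meets.
have [i [ii ipi _]] :=
  dense_matching_extension cU lphi lpi mM (dom_meets_dense dD GM).
by exists i.
Qed.

(** Back and forth: the n-th requirement concerns both the domain and the range,
and the range is treated by extending the converse matching. *)
Lemma urysohn_matching_extension (M0 : set (U * U)) :
  urysohn_field pi -> finite_set M0 -> matching pi pi M0 ->
  exists2 psi : U -> U, automorphism pi psi & forall p, M0 p -> psi p.1 = p.2.
Proof.
move=> upi fin0 m0.
have [[[cU [D /countable_injP[f finj] dD]] _ lpi] _] := upi.
pose G n M := dom_meets D f n M /\ dom_meets D f n (converse M).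
have [n M M' MM' [DM DN]|n M fM mM|M [mM M0M GM]] :=
  matching_chain (G := G) fin0 m0.
- split=> x Dx fx; [have [y Mxy] := DM x Dx fx|have [y Mxy] := DN x Dx fx];
    by exists y; exact: MM'.
- have [M1 [f1 m1 MM1 D1]] := urysohn_dom_meets upi lpi n finj fM mM.
  have [M2 [f2 m2 MM2 D2]] := urysohn_dom_meets upi lpi n finj
    (finite_converse f1) (matching_converse m1).
  exists (converse M2); split.
  + exact: finite_converse.
  + exact: matching_converse.
  + by move=> [a b] /MM1 Mab; exact: (MM2 (b, a)).
  + split=> // x Dx fx; have [y Mxy] := D1 x Dx fx.
    by exists y; exact: (MM2 (y, x)).
have dM : dense_dom M by apply: dom_meets_dense dD _ => n; exact: (GM n).1.
have dN : dense_dom (converse M).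
  by apply: dom_meets_dense dD _ => n; exact: (GM n).2.
have [i [ii ipi iP]] := dense_matching_extension cU lpi lpi mM dM.
have [j [_ _ jP]] :=
  dense_matching_extension cU lpi lpi (matching_converse mM) dN.
exists i; last first.
  move=> p /M0M Mp; apply: mdist_positivity.
  by rewrite -(iP _ _ Mp) mdistxx.
split=> //; exists j; first exact: dense_dom_converse_inverse dM iP jP.
apply: dense_dom_converse_inverse dN jP _ => x [a b]; exact: iP.
Qed.

Lemma urysohn_homogeneous (A A' : set U) (f : A -> A') :
  urysohn_field pi -> finite_set A -> partial_isometric_matching pi f ->
  exists2 psi : U -> U, automorphism pi psi & extends psi f.
Proof.
move=> upi finA [_ fi fpi].
pose M0 := range (fun x : A => (\val x, \val (f x))).
have finM0 : finite_set M0.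
  by apply: finite_image; rewrite (eq_finite_set (card_setT A)).
have mM0 : matching pi pi M0.
  split=> [_ _ [x _ <-] [y _ <-]|_ [x _ <-]] /=; last by rewrite fpi.
  exact/esym/fi.
have [psi apsi psiP] := urysohn_matching_extension upi finM0 mM0.
by exists psi => // x; apply: (psiP (\val x, \val (f x))); exists x.
Qed.

(** Universality gives a copy j of the extension in U that is correct up to the
position of A; homogeneity, applied to the map taking the copy of A back to A,
corrects it. *)
Lemma universal_homogeneous_urysohn :
  universal_field pi ->
  (forall (A A' : set U) (f : A -> A'),
     finite_set A -> partial_isometric_matching pi f ->
     exists2 psi : U -> U, automorphism pi psi & extends psi f) ->
  urysohn_field pi.
Proof.
move=> [fpi univ] homog; split=> // A E phi finA lphi phiA.
have finT : finite_set [set: A] by rewrite (eq_finite_set (card_setT A)).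
have finE : finite_set [set: ext_space E].
  apply: (@sub_finite_set _ _ (Some @` [set: A] `|` [set None])).
    by case=> [a|] _; [left; exists a|right].
  by rewrite finite_setU; split=> //; exact: finite_image.
have fphi : is_field phi.
  by have [_ pB _] := fpi; split=> //; exact: finite_polish.
have [j ij jphi] := univ _ phi fphi.
pose A1 := range (fun a : A => j (ext_incl E a)).
have j_dist (a b : A) :
    mdist (j (ext_incl E a)) (j (ext_incl E b)) = mdist (\val a) (\val b).
  by rewrite ij; exact: ext_dist_restr.
have /choice[g gP] : forall b : A1, exists a : A, j (ext_incl E a) = \val b.
  by move=> b; have [a _ <-] := set_valP b; exists a.
have ginv (a : A) : exists b : A1, \val b = j (ext_incl E a).
  have ha : A1 (j (ext_incl E a)) by exists a.
  by exists (SigSub (mem_set ha)).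
have [k kP] := choice ginv.
have kK : cancel k g.
  by move=> a; apply/val_inj/mdist_positivity; rewrite -j_dist gP kP mdistxx.
have gK : cancel g k by move=> b; apply/val_inj; rewrite kP gP.
have [] := homog A1 A g.
- exact: finite_image.
- split; first by exists k.
  + move=> x y; rewrite -[RHS]/(mdist (\val x) (\val y)) -!gP j_dist.
    by [].
  + by move=> x; rewrite -gP -phiA -[RHS]/((pi \o j) _) jphi.
move=> psi [_ psii psipi] psig; exists (psi \o j); split.
- by move=> p q /=; rewrite psii ij.
- by move=> a /=; rewrite -kP psig kK.
- by move=> p; rewrite -jphi; exact: psipi.
Qed.

End Urysohn.

Theorem theorem3p10 (R : realType) (U B : metricType R) (pi : U -> B)
    (hpi : is_field pi) :
  urysohn_field pi <->
  (universal_field pi /\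
   forall (A A' : set U) (f : A -> A'),
     finite_set A -> partial_isometric_matching pi f ->
     exists2 psi : U -> U, automorphism pi psi & extends psi f).
Proof.
split=> [upi|[univ homog]]; last exact: universal_homogeneous_urysohn.
by split=> [|A A' f]; [exact: urysohn_universal|exact: urysohn_homogeneous].
Qed.
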